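(* Let $n\ge1$, let $M=(M_0,\ldots,M_n)$ be a model of $VO_n$, let $A\subseteq M$ be finite, and let $E\subseteq M_0$ be $\mathcal{L}_n^*$-definable with parameters from $A$. Then $E$ has a unique canonical decomposition, and its extremities lie in $\langle A\rangle\cup\{\pm\infty\}$.
   Context: Let $\mathcal{L}_n^*$ be the $(n+1)$-sorted language with sorts $R_0, \ldots, R_n$, binary relation symbols $<_1,\ldots,<_n$ with $<_i$ on sort $R_i$, a constant symbol $0$ of sort $R_0$, and function symbols $f_i: R_0 \to R_i$ and $g_i: R_i \to R_0$ for $i=1,\ldots,n$. $VO_n$ is the $\mathcal{L}_n^*$-theory axiomatized by: (1) each $<_i$ is a dense linear order without endpoints on $R_i$; (2) each $f_i$ is injective; (3) $g_i(x)=f_i^{-1}(x)$ if $x \in f_i(R_0)$ and $g_i(x)=0$ otherwise; (4) $f_i(R_0)$ is $<_i$-dense and $<_i$-co-dense in $R_i$; (5) whenever $a_i <_i b_i$ in $R_i$ for all $i$, there is $x_0 \in R_0$ with $a_i <_i f_i(x_0) <_i b_i$ for all $i$. In a model $M=(M_0,\ldots,M_n)$, $M_i$ interprets sort $R_i$, and $\langle A\rangle$ is the $\mathcal{L}_n^*$-substructure generated by $A$. A multi-interval is a set $I=\bigcap_{i=1}^n f_i^{-1}(I^i)\subseteq M_0$ with each $I^i$ a nonempty $<_i$-open interval in $M_i$; its extremities are the endpoints of all the $I^i$. For $E \subseteq M_0$ and $e\in E$, a multi-interval $I=\bigcap_{i=1}^n f_i^{-1}(I^i)$ with $e \in I\subseteq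 E$ is the maximal multi-interval in $E$ containing $e$ if for every $m\in\{1,\ldots,n\}$, $I^m$ is the maximal $<_m$-interval such that $f_m(e)\in I^m$ and there exist intervals $J^{m+1},\ldots,J^n$ in $M_{m+1},\ldots,M_n$ with $f_j(e)\in J^j$ for $j>m$ and $\bigcap_{l=1}^m f_l^{-1}(I^l)\cap\bigcap_{j=m+1}^n f_j^{-1}(J^j)\subseteq E$. Given $E\subseteq M_0$, finite sets $B\subseteq\mathbb{N}$ and $E_0\subseteq E$, and multi-intervals $I_j$ ($j\in B$), the expression $\bigcup_{j\in B}I_j\cup E_0$ is a canonical decomposition of $E$ if: (1) $E=\bigcup_{j\in B}I_j\cup E_0$; (2) no $e\in E_0$ lies in a multi-interval contained in $E$; (3) for every $e\in E\setminus E_0$ there is $j\in B$ such that $I_j$ is the maximal multi-interval in $E$ containing $e$; (4) for every $j\in B$ there is $e\in E\setminus E_0$ such that $I_j$ is the maximal multi-interval in $E$ containing $e$. *)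

(* Defs.v *)
From mathcomp Require Import all_boot.
From mathcomp Require Import boolp classical_sets functions cardinality.

Set Implicit Arguments.
Unset Strict Implicit.
Unset Printing Implicit Defensive.

Local Open Scope classical_set_scope.

(* Indices i : 'I_n run over 0, ..., n - 1, so [Rs i] is the sort R_{i+1};    *)
(* likewise for the symbols <_{i+1}, f_{i+1}, g_{i+1}.                        *)
Inductive vsort (n : nat) : Type := R0 | Rs of 'I_n.
Arguments R0 {n}.

Record structure (n : nat) : Type := Structure {
  carrier :> vsort n -> Type;
  zeroM : carrier R0;
  ltM : forall i : 'I_n, carrier (Rs i) -> carrier (Rs i) -> Prop;
  fM : forall i : 'I_n, carrier R0 -> carrier (Rs i);
  gM : forall i : 'I_n, carrier (Rs i) -> carrier R0 }.
Arguments zeroM {n} _.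
Arguments ltM {n} _ _ _ _.
Arguments fM {n} _ _ _.
Arguments gM {n} _ _ _.

(* First-order formulas of the language, with intrinsically sorted de Bruijn  *)
(* variables: a context lists the sorts of the free variables.                *)
Inductive var (n : nat) : seq (vsort n) -> vsort n -> Type :=
  | VZ G s : var (s :: G) s
  | VS G s t : var G s -> var (t :: G) s.

Inductive term (n : nat) (G : seq (vsort n)) : vsort n -> Type :=
  | TVar s : var G s -> term G s
  | TZero : term G R0
  | TF i : term G R0 -> term G (Rs i)
  | TG i : term G (Rs i) -> term G R0.

Inductive formula (n : nat) : seq (vsort n) -> Type :=
  | FEq G s : term G s -> term G s -> formula G
  | FLt G (i : 'I_n) : term G (Rs i) -> term G (Rs i) -> formula G
  | FNot G : formula G -> formula G
  | FAnd G : formula G -> formula G -> formula G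
  | FEx G s : formula (s :: G) -> formula G.

Fixpoint env n (M : structure n) (G : seq (vsort n)) : Type :=
  match G with
  | [::] => unit
  | s :: G' => (M s * env M G')%type
  end.

Fixpoint eval_var n (M : structure n) G s (v : var G s) : env M G -> M s :=
  match v in var G s return env M G -> M s with
  | VZ _ _ => fun e => e.1
  | VS _ _ _ v' => fun e => eval_var v' e.2
  end.

Fixpoint eval n (M : structure n) G s (t : term G s) (e : env M G) : M s :=
  match t in term _ s return M s with
  | TVar _ v => eval_var v e
  | TZero => zeroM M
  | TF i t' => fM M i (eval t' e)
  | TG i t' => gM M i (eval t' e)
  end.

Fixpoint holds n (M : structure n) G (phi : formula G) : env M G -> Prop :=
  match phi in formula G return env M G -> Prop with
  | FEq _ _ t u => fun e => eval t e = eval u e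
  | FLt _ i t u => fun e => ltM M i (eval t e) (eval u e)
  | FNot _ p => fun e => ~ holds p e
  | FAnd _ p q => fun e => holds p e /\ holds q e
  | FEx _ s p => fun e => exists a : M s, holds (M := M) p (a, e)
  end.

Fixpoint env_in n (M : structure n) (A : forall s, set (M s)) G :
    env M G -> Prop :=
  match G return env M G -> Prop with
  | [::] => fun=> True
  | s :: G' => fun e => A s e.1 /\ env_in A e.2
  end.

Definition definable_over n (M : structure n) (A : forall s, set (M s))
    (E : set (M R0)) : Prop :=
  exists (G : seq (vsort n)) (phi : formula (R0 :: G)) (a : env M G),
    env_in A a /\ E = [set x | holds (M := M) phi (x, a)].

Inductive generated n (M : structure n) (A : forall s, set (M s)) :
    forall s, M s -> Prop :=
  | gen_base s a : A s a -> generated A a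
  | gen_zero : generated A (zeroM M)
  | gen_f i x : generated A x -> generated A (fM M i x)
  | gen_g i y : generated A y -> generated A (gM M i y).

Definition dlo_without_endpoints (T : Type) (R : T -> T -> Prop) : Prop :=
  [/\ (forall x, ~ R x x),
      (forall x y z, R x y -> R y z -> R x z),
      (forall x y, [\/ R x y, x = y | R y x]),
      (forall x y, R x y -> exists z, R x z /\ R z y) &
      (forall x, (exists y, R y x) /\ (exists y, R x y))].

Record VO n (M : structure n) : Prop := {
  VO_dlo : forall i, dlo_without_endpoints (ltM M i);
  VO_inj : forall i, injective (fM M i);
  VO_g_im : forall i x y, fM M i x = y -> gM M i y = x;
  VO_g_out : forall i y, ~ range (fM M i) y -> gM M i y = zeroM M;
  VO_dense : forall i a b, ltM M i a b ->
    exists y, [/\ range (fM M i) y, ltM M i a y & ltM M i y b];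
  VO_codense : forall i a b, ltM M i a b ->
    exists y, [/\ ~ range (fM M i) y, ltM M i a y & ltM M i y b];
  VO_indep : forall a b : (forall i, M (Rs i)),
    (forall i, ltM M i (a i) (b i)) ->
    exists x, forall i, ltM M i (a i) (fM M i x) /\ ltM M i (fM M i x) (b i) }.

Inductive extended (T : Type) : Type := MInfty | Fin of T | PInfty.
Arguments MInfty {T}.
Arguments PInfty {T}.

Definition lt_ext (T : Type) (R : T -> T -> Prop) (a b : extended T) : Prop :=
  match a, b with
  | Fin x, Fin y => R x y
  | MInfty, Fin _ | MInfty, PInfty | Fin _, PInfty => True
  | _, _ => False
  end.

(* An open interval is given by its lower and upper endpoints. *)
Definition ointerval n (M : structure n) (i : 'I_n) : Type :=
  (extended (M (Rs i)) * extended (M (Rs i)))%type.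

Definition iset n (M : structure n) (i : 'I_n) (J : ointerval M i) :
    set (M (Rs i)) :=
  [set y | lt_ext (ltM M i) J.1 (Fin y) /\ lt_ext (ltM M i) (Fin y) J.2].

(* In a model of VO, the family of intervals (hence of endpoints) of a        *)
(* multi-interval is determined by its underlying subset [mset] of M R0.      *)
Definition intervals n (M : structure n) : Type := forall i : 'I_n, ointerval M i.

Definition mset n (M : structure n) (I : intervals M) : set (M R0) :=
  [set x | forall i, iset (I i) (fM M i x)].

Definition multi_interval n (M : structure n) (I : intervals M) : Prop :=
  forall i, iset (I i) !=set0.

(* [extendable E e I m K] is the condition on the m-th interval K, the        *)
(* intervals I l with l < m being fixed; only the J j with j > m matter.      *)
Definition extendable n (M : structure n) (E : set (M R0)) (e : M R0)
    (I : intervals M) (m : 'I_n) (K : ointerval M m) : Prop :=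
  iset K (fM M m e) /\
  exists J : intervals M,
    (forall j : 'I_n, (m < j)%N -> iset (J j) (fM M j e)) /\
    [set x | [/\ forall l : 'I_n, (l < m)%N -> iset (I l) (fM M l x),
                 iset K (fM M m x) &
                 forall j : 'I_n, (m < j)%N -> iset (J j) (fM M j x)]] `<=` E.

Definition maximal_in n (M : structure n) (E : set (M R0)) (e : M R0)
    (I : intervals M) : Prop :=
  [/\ multi_interval I,
      mset I e,
      mset I `<=` E &
      forall m : 'I_n,
        extendable E e I (I m) /\
        forall K : ointerval M m, extendable E e I K ->
          iset (I m) `<=` iset K -> iset K = iset (I m)].

Record canonical_decomposition n (M : structure n) (E : set (M R0))
    (B : set nat) (I : nat -> intervals M) (E0 : set (M R0)) : Prop := {
  cd_finB : finite_set B;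
  cd_finE0 : finite_set E0;
  cd_subE0 : E0 `<=` E;
  cd_multi : forall j, B j -> multi_interval (I j);
  cd_union : E = (\bigcup_(j in B) mset (I j)) `|` E0;
  cd_isolated : forall e, E0 e ->
    ~ exists I' : intervals M,
        [/\ multi_interval I', mset I' e & mset I' `<=` E];
  cd_cover : forall e, (E `\` E0) e -> exists2 j, B j & maximal_in E e (I j);
  cd_used : forall j, B j -> exists2 e, (E `\` E0) e & maximal_in E e (I j) }.

Definition in_ext (T : Type) (S : T -> Prop) (a : extended T) : Prop :=
  match a with Fin x => S x | _ => True end.

(* Main.v *)
(* Let C = <A>, a finite set.  Finite partial isomorphisms between            *)
(* substructures of M have the back-and-forth property (by density,           *)
(* co-density and axiom (5)), so they preserve formulas; hence whether x lies *)
(* in E depends only on the cuts of the f_i(x) in the sets C_i.  Moving a     *)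
(* point inside its cell with axiom (5), one sees that in any multi-interval  *)
(* contained in E a single interval can be enlarged until its endpoints lie   *)
(* in C or are infinite.  So the successive maximal intervals are maxima over *)
(* finitely many candidates, there are finitely many maximal multi-intervals, *)
(* and the points of E in no multi-interval belong to C_0.                    *)
Require Import Defs.
From mathcomp Require Import all_boot.
From mathcomp Require Import boolp classical_sets functions cardinality.

Set Implicit Arguments.
Unset Strict Implicit.
Unset Printing Implicit Defensive.

Local Open Scope classical_set_scope.

(** Let C be the substructure generated by A; it is finite ([generated_finite]). By back-and-forth
    ([partial_iso_forth], [holds_rel]), membership of x in E depends only on the cuts of the
    coordinates f_i(x) over C ([definable_same_cut]). Axiom (5) makes the coordinates independent,
    so one interval of a box inside E can be stretched until its endpoints lie in C or are infinite
    ([mset_enlarge]).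

    Once the earlier intervals are fixed, the admissible m-th intervals around e are closed under
    union and have finitely many relevant endpoints, so there is a largest one
    ([box_extendable_largest]). Choosing coordinate by coordinate yields a family that is the only
    maximal multi-interval at e ([largest_in_exists], [maximal_in_largest]). Both parts of a
    decomposition are therefore forced: the isolated points are those of E in no multi-interval, and
    the boxes are all the maximal multi-intervals. Both sets are finite because C is. *)

(** * Finite sets and strict linear orders *)

Lemma finite_enum (T : Type) (x0 : T) (A : set T) :
  finite_set A -> exists (f : nat -> T) (n : nat), A = f @` `I_n.
Proof.
move=> -[n /card_set_bijP[g gbij]].
have h k : exists x, (k < n)%N -> A x /\ g x = k.
  have [kn|_] := boolP (k < n)%N; last by exists x0.
  by have [x Ax gx] := set_bij_surj gbij kn; exists x.
have {h} [f fP] := choice h; exists f, n; apply/seteqP; split=> [x Ax|x].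
- have gxn : (g x < n)%N by apply: (set_bij_sub gbij); exists x.
  have [Af gf] := fP _ gxn; exists (g x) => //.
  by apply: (set_bij_inj gbij); rewrite ?inE.
- by case=> k kn <-; case: (fP k kn).
Qed.

Definition strict_total (T : Type) (R : T -> T -> Prop) : Prop :=
  [/\ forall x, ~ R x x,
      forall x y z, R x y -> R y z -> R x z &
      forall x y, [\/ R x y, x = y | R y x]].

Lemma strict_total_flip (T : Type) (R : T -> T -> Prop) :
  strict_total R -> strict_total (fun x y => R y x).
Proof.
case=> irr tr tot; split=> [//|x y z xy yz|x y]; first exact: tr yz xy.
by case: (tot x y) => h; [apply: Or33|apply: Or32|apply: Or31].
Qed.

Lemma strict_total_NR (T : Type) (R : T -> T -> Prop) : strict_total R ->
  forall x y z, ~ R y x -> R y z -> R x z.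
Proof.
case=> irr tr tot x y z nyx yz.
by case: (tot x y) => [xy|->|//]; first exact: tr yz.
Qed.

Lemma strict_total_RN (T : Type) (R : T -> T -> Prop) : strict_total R ->
  forall x y z, R x y -> ~ R z y -> R x z.
Proof.
move=> /strict_total_flip Rl x y z xy nzy.
exact: (strict_total_NR Rl nzy xy).
Qed.

Lemma finite_max (T : Type) (R : T -> T -> Prop) (A : set T) :
  strict_total R -> finite_set A -> A !=set0 ->
  exists2 x, A x & forall y, A y -> ~ R x y.
Proof.
move=> [irr tr tot] Afin [a Aa].
have [f [n Af]] := finite_enum a Afin.
suff [k kn kmax] : exists2 k, (k < n)%N & forall j, (j < n)%N -> ~ R (f k) (f j).
  exists (f k); first by rewrite Af; exists k.
  by move=> y; rewrite Af => -[j jn <-]; exact: kmax.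
have {A Afin Aa Af} : (0 < n)%N by move: Aa; rewrite Af => -[[|k]]; case: n {Af}.
case: n => // n _; elim: n => [|n [k kn kmax]].
  by exists 0 => // -[] // _; exact: irr.
have [kn1|nkn1] := pselect (R (f k) (f n.+1)).
  exists n.+1 => // j; rewrite ltnS leq_eqVlt => /orP[/eqP->|jn]; first exact: irr.
  by move=> nj; apply: (kmax j jn); exact: tr nj.
exists k => [|j]; first exact: ltnW.
by rewrite ltnS leq_eqVlt => /orP[/eqP->|]; [|exact: kmax].
Qed.

Lemma dlo_strict_total (T : Type) (R : T -> T -> Prop) :
  dlo_without_endpoints R -> strict_total R.
Proof. by case. Qed.

Lemma dlo_flip (T : Type) (R : T -> T -> Prop) :
  dlo_without_endpoints R -> dlo_without_endpoints (fun x y => R y x).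
Proof.
move=> dR; have [irr tr tot] := strict_total_flip (dlo_strict_total dR).
case: dR => _ _ _ dn ne; split=> // [x y yx|x].
  by have [z [? ?]] := dn _ _ yx; exists z.
by case: (ne x).
Qed.

(** The minimum of [U] serves as [b], hence the negated conclusion; if [U] is empty, any point above
    [t] will do. *)
Lemma dlo_lower_bound (T : Type) (R : T -> T -> Prop) (U : set T) (t : T) :
  dlo_without_endpoints R -> finite_set U -> (forall u, U u -> R t u) ->
  exists2 b, R t b & forall u, U u -> ~ R u b.
Proof.
move=> dR Ufin tU; have Rl := dlo_strict_total dR.
have [[u Uu]|/set0P/negP/negPn/eqP ->] := pselect (U !=set0).
  have [b Ub bmin] := finite_max (strict_total_flip Rl) Ufin (ex_intro _ u Uu).
  by exists b; [exact: tU|].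
by case: dR => _ _ _ _ /(_ t)[_ [b tb]]; exists b.
Qed.

Lemma dlo_upper_bound (T : Type) (R : T -> T -> Prop) (L : set T) (t : T) :
  dlo_without_endpoints R -> finite_set L -> (forall l, L l -> R l t) ->
  exists2 a, R a t & forall l, L l -> ~ R a l.
Proof. by move=> /dlo_flip; exact: dlo_lower_bound. Qed.

Lemma dlo_cut (T : Type) (R : T -> T -> Prop) (L U : set T) (t : T) :
  dlo_without_endpoints R -> finite_set L -> finite_set U ->
  (forall l u, L l -> U u -> R l u) ->
  exists a b, [/\ R a b, forall l, L l -> ~ R a l & forall u, U u -> ~ R u b].
Proof.
move=> dR Lfin Ufin LU; have Rl := dlo_strict_total dR.
suff [a [aL aU]] : exists a, (forall l, L l -> ~ R a l) /\
                            (forall u, U u -> R a u).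
  by have [b ab bU] := dlo_lower_bound dR Ufin aU; exists a, b.
have [L0|/set0P/negP/negPn/eqP L0] := pselect (L !=set0).
  have [a La amax] := finite_max Rl Lfin L0.
  by exists a; split=> // u; exact: LU.
have [U0|/set0P/negP/negPn/eqP U0] := pselect (U !=set0); last first.
  by exists t; rewrite L0 U0; split.
have [b Ub bmin] := finite_max (strict_total_flip Rl) Ufin U0.
case: (dR) => _ _ _ _ /(_ b)[[a ab] _]; exists a; split=> [l|u Uu].
  by rewrite L0.
exact: (strict_total_RN Rl ab (bmin u Uu)).
Qed.

(** * Open intervals with extended endpoints in one dense order *)

Lemma lt_ext_strict_total (T : Type) (R : T -> T -> Prop) :
  strict_total R -> strict_total (lt_ext R).
Proof.
case=> irr tr tot; split=> [[|x|] //=|[|x|] [|y|] [|z|] //=|]; first exact: tr.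
move=> [|x|] [|y|] /=; try by [apply: Or31|apply: Or32|apply: Or33].
by case: (tot x y) => [h|->|h]; [apply: Or31|apply: Or32|apply: Or33].
Qed.

Lemma finite_in_ext (T : Type) (C : set T) :
  finite_set C -> finite_set [set a | in_ext C a].
Proof.
move=> Cfin; apply: (@sub_finite_set _ _ ([set MInfty; PInfty] `|` (@Fin T) @` C)).
  by move=> [|x|] /= Cx; [left; left|right; exists x|left; right].

by rewrite finite_setU; split; [exact: finite_set2|exact: finite_image].
Qed.

(** Convertible to [iset], but over a bare relation, so that results about one order can also be
    applied to the reverse order. *)
Definition oint (T : Type) (R : T -> T -> Prop)
    (K : extended T * extended T) : set T :=
  [set y | lt_ext R K.1 (Fin y) /\ lt_ext R (Fin y) K.2].

(** In a strict total order this forces [x = y] as soon as one of them lies in [C]. *)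
Definition same_cut (T : Type) (R : T -> T -> Prop) (C : set T) (x y : T) :=
  forall c, C c -> (R c x <-> R c y) /\ (R x c <-> R y c).

Lemma same_cut_flip (T : Type) (R : T -> T -> Prop) (C : set T) (x y : T) :
  same_cut (fun x y => R y x) C x y <-> same_cut R C x y.
Proof. by split=> h c /h[]. Qed.

Lemma same_cut_notin (T : Type) (R : T -> T -> Prop) (C : set T) (x y : T) :
  strict_total R -> same_cut R C x y -> ~ C x -> ~ C y.
Proof.
move=> [irr _ tot] xy nCx Cy; case: (xy y Cy) => h1 h2.
case: (tot x y) => [/h2/irr|e|/h1/irr] //.
by apply: nCx; rewrite e.
Qed.

(** Since [t] is not in [C], the points of [C] and the finite endpoints of [K] all lie strictly on
    one side of [t]; the nearest ones bound the neighbourhood. *)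
Lemma oint_nbhd (T : Type) (R : T -> T -> Prop) (C : set T) K (t : T) :
  dlo_without_endpoints R -> finite_set C -> ~ C t -> oint R K t ->
  exists a b, [/\ R a t, R t b &
    forall y, R a y -> R y b -> oint R K y /\ same_cut R C t y].
Proof.
move=> dR Cfin nCt [K1 K2]; have Rl := dlo_strict_total dR.
have [irr tr tot] := Rl; have [_ ext_tr _] := lt_ext_strict_total Rl.
have [||a at_ aL] := @dlo_upper_bound T R
    ([set c | C c /\ R c t] `|` [set c | Fin c = K.1]) t dR.
- rewrite finite_setU; split; first by apply: sub_finite_set Cfin => c [].
  case: (K.1) => [|k|]; try by apply: (@sub_finite_set _ _ set0).
  by apply: (@sub_finite_set _ _ [set k]) => // c [->].
- by move=> l [[]//|/=]; move: K1; case: (K.1) => //= k kt [->].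
have [||b tb bU] := @dlo_lower_bound T R
    ([set c | C c /\ R t c] `|` [set c | Fin c = K.2]) t dR.
- rewrite finite_setU; split; first by apply: sub_finite_set Cfin => c [].
  case: (K.2) => [|k|]; try by apply: (@sub_finite_set _ _ set0).
  by apply: (@sub_finite_set _ _ [set k]) => // c [->].
- by move=> l [[]//|/=]; move: K2; case: (K.2) => //= k kt [->].
exists a, b; split=> // y ay yb; split; first split.
- case: (K.1) K1 aL => // k _ aL.
  by apply: (strict_total_NR Rl _ ay); apply: aL; right.
- case: (K.2) K2 bU => // k _ bU.
  by apply: (strict_total_RN Rl yb); apply: bU; right.
move=> c Cc; case: (tot c t) => [ct|e|tc]; last 2 first.
- by case: nCt; rewrite -e.
- have yc : R y c by apply: (strict_total_RN Rl yb); apply: bU; left.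
  by split; split=> // h; exfalso; apply: (irr c); [apply: tr tc|apply: tr yc].
have cy : R c y by apply: (strict_total_NR Rl _ ay); apply: aL; left.
by split; split=> // h; exfalso; apply: (irr c); [apply: tr h|apply: tr h].
Qed.

Lemma oint_extend_left (T : Type) (R : T -> T -> Prop) (C : set T) K (e : T) :
  dlo_without_endpoints R -> finite_set C -> oint R K e ->
  exists a, [/\ in_ext C a, ~ lt_ext R K.1 a &
    forall x, lt_ext R a (Fin x) -> ~ lt_ext R K.1 (Fin x) ->
      ~ C x /\ exists2 y, oint R K y & same_cut R C x y].
Proof.
move=> dR Cfin; have Rl := dlo_strict_total dR.
have [irr tr tot] := Rl.
case: K => [[|k|] k2] [] //= K1 K2.
  by exists MInfty; split=> // x _ /(_ I).
(* [a] is the greatest element of [C] or minus infinity not beyond [k], so no point of [C] lies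
   strictly between [a] and [k], nor at [k] unless [a] is [k]. *)
have [||a [Ca ka] amax] := @finite_max (extended T) (lt_ext R)
    [set a | in_ext C a /\ ~ lt_ext R (Fin k) a] (lt_ext_strict_total Rl).
- by apply: sub_finite_set (finite_in_ext Cfin) => c [].
- by exists MInfty; split.
exists a; split=> // x ax nkx.
have low c : C c -> R c x \/ R k c.
  move=> Cc; have [kc|nkc] := pselect (R k c); [by right|left].
  exact: (strict_total_NR (lt_ext_strict_total Rl) (amax (Fin c) (conj Cc nkc)) ax).
split=> [Cx|].
  by case: (low x Cx) => //; exact: irr.
(* A point [y] just to the right of [k], before [e] and before the next point of [C], lies in [K]
   and has the cut of [x]. *)
have [||b kb bU] := @dlo_lower_bound T R ([set c | C c /\ R k c] `|` [set e]) k dR.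
- rewrite finite_setU; split; last exact: finite_set1.
  by apply: sub_finite_set Cfin => c [].
- by move=> u [[]//|->].
case: (dR) => _ _ _ /(_ _ _ kb)[y [ky yb]] _; exists y.
  split=> //=; have ye : R y e by apply: (strict_total_RN Rl yb); apply: bU; right.
  by case: k2 K2 => //= k2; exact: tr.
have xy : R x y by apply: (strict_total_NR Rl nkx).
move=> c Cc; case: (low c Cc) => [cx|kc].
  have cy := tr _ _ _ cx xy.
  by split; split=> // h; exfalso; apply: (irr c); [apply: tr h|apply: tr h].
have xc : R x c by apply: (strict_total_NR Rl nkx).
have yc : R y c by apply: (strict_total_RN Rl yb); apply: bU; left.
by split; split=> // h; exfalso; apply: (irr c); [apply: tr xc|apply: tr yc].
Qed.

(** Reversing the order swaps the infinities; right-hand statements are then left-hand ones for the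
    reverse order. *)
Definition ext_opp (T : Type) (a : extended T) : extended T :=
  match a with MInfty => PInfty | Fin x => Fin x | PInfty => MInfty end.

Lemma lt_ext_opp (T : Type) (R : T -> T -> Prop) a b :
  lt_ext (fun x y => R y x) (ext_opp a) (ext_opp b) = lt_ext R b a.
Proof. by case: a b => [|x|] []. Qed.

Lemma oint_opp (T : Type) (R : T -> T -> Prop) K :
  oint (fun x y => R y x) (ext_opp K.2, ext_opp K.1) = oint R K.
Proof.
apply/seteqP; split=> y; rewrite /oint /= -!(lt_ext_opp (fun x y => R y x));
by rewrite -/(ext_opp (Fin y)); case: (K.1) (K.2) => [|k1|] [|k2|] [].
Qed.

Lemma oint_extend_right (T : Type) (R : T -> T -> Prop) (C : set T) K (e : T) :
  dlo_without_endpoints R -> finite_set C -> oint R K e ->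
  exists b, [/\ in_ext C b, ~ lt_ext R b K.2 &
    forall x, lt_ext R (Fin x) b -> ~ lt_ext R (Fin x) K.2 ->
      ~ C x /\ exists2 y, oint R K y & same_cut R C x y].
Proof.
move=> dR Cfin; rewrite -oint_opp => Ke.
have [b [Cb Kb bP]] := oint_extend_left (dlo_flip dR) Cfin Ke.
exists (ext_opp b); split; first by case: b Cb {Kb bP}.
  by rewrite -(lt_ext_opp R); case: b Kb {Cb bP}.
move=> x xb xK; have [] := bP x.
- by move: xb; rewrite -(lt_ext_opp R); case: b {Cb Kb bP}.
- by move: xK; rewrite -(lt_ext_opp R).
move=> nCx [y Ky xy]; split=> //; exists y => //.
exact/(same_cut_flip R).
Qed.

(* [K'] is bounded by the points of [C] nearest to [K] on the outside, so     *)
(* that [K'] minus [K] does not meet [C].                                     *)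
Lemma oint_extend (T : Type) (R : T -> T -> Prop) (C : set T) K (e : T) :
  dlo_without_endpoints R -> finite_set C -> oint R K e ->
  exists K', [/\ in_ext C K'.1, in_ext C K'.2, oint R K `<=` oint R K' &
    forall x, oint R K' x -> oint R K x \/
      ~ C x /\ exists2 y, oint R K y & same_cut R C x y].
Proof.
move=> dR Cfin Ke; have Rl := lt_ext_strict_total (dlo_strict_total dR).
have [a [Ca Ka aP]] := oint_extend_left dR Cfin Ke.
have [b [Cb Kb bP]] := oint_extend_right dR Cfin Ke.
exists (a, b); split=> // [y [K1 K2]|x [/= ax xb]].
  by split; [exact: (strict_total_NR Rl Ka)|exact: (strict_total_RN Rl _ Kb)].
have [K1|nK1] := pselect (lt_ext R K.1 (Fin x)); last by right; exact: aP.
have [K2|nK2] := pselect (lt_ext R (Fin x) K.2); last by right; exact: bP.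
by left.
Qed.

(** If the left endpoint of [K'] were beyond that of [K], it would belong to [K], hence to the open
    interval [K'] itself. *)
Lemma oint_sub_left (T : Type) (R : T -> T -> Prop) K K' (y : T) :
  strict_total R -> oint R K y -> oint R K' y -> oint R K `<=` oint R K' ->
  ~ lt_ext R K.1 K'.1.
Proof.
move=> Rl [_ K2] [+ _] KK' KltK'; have [irr _ _] := Rl.
have [_ ext_tr _] := lt_ext_strict_total Rl.
case: K' KltK' KK' => [[|t|] k'] /=; [by case: (K.1)| |by []].
move=> Kt KK' ty; have [] : oint R (Fin t, k') t.
  by apply: KK'; split=> //; exact: (ext_tr _ (Fin y)).
by move/irr.
Qed.

Lemma oint_sub_right (T : Type) (R : T -> T -> Prop) K K' (y : T) :
  strict_total R -> oint R K y -> oint R K' y -> oint R K `<=` oint R K' ->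
  ~ lt_ext R K'.2 K.2.
Proof.
move=> Rl; rewrite -(oint_opp R K) -(oint_opp R K') => Ky K'y KK'.
rewrite -(lt_ext_opp R).
exact: (oint_sub_left (strict_total_flip Rl) Ky K'y KK').
Qed.

Lemma oint_endpoints_inj (T : Type) (R : T -> T -> Prop) K K' :
  strict_total R -> oint R K !=set0 -> oint R K = oint R K' -> K = K'.
Proof.
move=> Rl [y Ky] KK'; have K'y : oint R K' y by rewrite -KK'.
have sKK' : oint R K `<=` oint R K' by rewrite KK'.
have sK'K : oint R K' `<=` oint R K by rewrite KK'.
have [_ _ tot] := lt_ext_strict_total Rl.
have := oint_sub_left Rl Ky K'y sKK'; have := oint_sub_left Rl K'y Ky sK'K.
have := oint_sub_right Rl Ky K'y sKK'; have := oint_sub_right Rl K'y Ky sK'K.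
case: K K' {Ky K'y sKK' sK'K KK'} => [a b] [a' b'] /=.
by case: (tot a a') => // ->; case: (tot b b') => // ->.
Qed.

Lemma oint_capS (T : Type) (R : T -> T -> Prop) K K' (e : T) :
  strict_total R -> oint R K e -> oint R K' e ->
  exists K'', oint R K'' e /\ oint R K'' `<=` oint R K `&` oint R K'.
Proof.
move=> /lt_ext_strict_total Rl [K1 K2] [K1' K2'].
have [a [ae aK aK']] : exists a,
    [/\ lt_ext R a (Fin e), ~ lt_ext R a K.1 & ~ lt_ext R a K'.1].
  have [irr tr tot] := Rl.
  have [h|h] := pselect (lt_ext R K.1 K'.1).
    exists K'.1; split=> // h'; apply: irr; exact: tr h h'.
  by exists K.1; split=> //; apply: irr.
have [b [eb bK bK']] : exists b,
    [/\ lt_ext R (Fin e) b, ~ lt_ext R K.2 b & ~ lt_ext R K'.2 b].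
  have [irr tr tot] := Rl.
  have [h|h] := pselect (lt_ext R K'.2 K.2).
    exists K'.2; split=> // h'; apply: irr; exact: tr h h'.
  by exists K.2; split=> //; apply: irr.
exists (a, b); split=> // y [/= ay yb].
split; split; [exact: strict_total_NR aK ay | exact: strict_total_RN yb bK
  | exact: strict_total_NR aK' ay | exact: strict_total_RN yb bK'].
Qed.

(** * Back-and-forth between finite partial isomorphisms *)

Definition sorted_rel n (M : structure n) : Type :=
  forall s : vsort n, M s -> M s -> Prop.

(** A relation rather than a function: inverting is a flip and extending is a disjunction. Being
    single-valued and injective follows from [pi_lt], see [partial_iso_eq]. *)
Record partial_iso n (M : structure n) (r : sorted_rel M) : Prop := {
  pi_fin : forall i, finite_set [set p : M (Rs i) * M (Rs i) | r _ p.1 p.2];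
  pi_zero : r R0 (zeroM M) (zeroM M);
  pi_f : forall i x x', r R0 x x' -> r (Rs i) (fM M i x) (fM M i x');
  pi_g : forall i y y', r (Rs i) y y' -> r R0 (gM M i y) (gM M i y');
  pi_lt : forall i y y' z z', r (Rs i) y y' -> r (Rs i) z z' ->
    ltM M i y z <-> ltM M i y' z' }.

Lemma partial_iso_flip n (M : structure n) (r : sorted_rel M) :
  partial_iso r -> partial_iso (fun s x y => r s y x).
Proof.
case=> rfin r0 rf rg rlt; split=> [i||i x x'|i y y'|i y y' z z' yy' zz'] //.
- apply: sub_finite_set (finite_image (fun p => (p.2, p.1)) (rfin i)).
  by move=> [y y'] /= yy'; exists (y', y).
- exact: rf.
- exact: rg.
- by have := rlt _ _ _ _ _ yy' zz' => -[].
Qed.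

Section Models.
Variables (n : nat) (n_ge1 : (1 <= n)%N) (M : structure n) (M_VO : VO M).

Let sto i : strict_total (ltM M i) := dlo_strict_total (VO_dlo M_VO i).

Lemma gfK i x : gM M i (fM M i x) = x.
Proof. exact: (VO_g_im M_VO). Qed.

(** In an ordered sort, equality means that neither point is below the other. The sort [R0] has no
    order, so equality there is read off through an injective f_i, whose index comes from
    [n_ge1]. *)
Lemma partial_iso_eq (r : sorted_rel M) s (x x' y y' : M s) : partial_iso r ->
  r s x x' -> r s y y' -> x = y <-> x' = y'.
Proof.
move=> [_ _ rf _ rlt].
have eq_i i (z z' t t' : M (Rs i)) : r _ z z' -> r _ t t' -> z = t <-> z' = t'.
  move=> zz' tt'; have [irr _ tot] := sto i.
  have h1 := rlt _ _ _ _ _ zz' tt'; have h2 := rlt _ _ _ _ _ tt' zz'.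
  split=> e; [case: (tot z' t') => [/h1||/h2] //|case: (tot z t) => [/h1||/h2] //];
  by rewrite e => /irr.
case: s x x' y y' => [|i] x x' y y' xx' yy'; last exact: eq_i.
pose i := Ordinal n_ge1.
have [h h'] := eq_i i _ _ _ _ (rf i _ _ xx') (rf i _ _ yy').
by split=> e; apply: (VO_inj M_VO (i := i)); [apply: h|apply: h']; rewrite e.
Qed.

(** One pair per sort at once, because a new point of [R0] brings all its images under the f_i. *)
Definition add_pairs (r : sorted_rel M) (x x' : M R0)
    (y y' : forall i, M (Rs i)) : sorted_rel M :=
  fun s => match s with
  | R0 => fun a b => r R0 a b \/ a = x /\ b = x'
  | Rs i => fun a b => r (Rs i) a b \/ a = y i /\ b = y' i
  end.

Lemma partial_iso_add (r : sorted_rel M) x x' (y y' : forall i, M (Rs i)) :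
  partial_iso r ->
  (forall i, add_pairs r x x' y y' (fM M i x) (fM M i x')) ->
  (forall i, add_pairs r x x' y y' (gM M i (y i)) (gM M i (y' i))) ->
  (forall i z z', r (Rs i) z z' ->
     (ltM M i z (y i) <-> ltM M i z' (y' i)) /\
     (ltM M i (y i) z <-> ltM M i (y' i) z')) ->
  partial_iso (add_pairs r x x' y y').
Proof.
move=> [rfin r0 rf rg rlt] hf hg hlt.
split=> [i||i a a' [/rf|[-> ->]]|i a a' [aa'|[-> ->]]|i a a' b b'] //=.
- apply: (@sub_finite_set _ _ ([set p | r _ p.1 p.2] `|` [set (y i, y' i)])).
    by move=> [a b] /= [|[-> ->]]; [left|right].
  by rewrite finite_setU; split; [exact: rfin|exact: finite_set1].
- by left.
- by left.
- exact: hf.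
- by left; exact: rg.
- exact: hg.
have [irr _ _] := sto i.
move=> [aa'|[-> ->]] [bb'|[-> ->]]; first exact: rlt.
- by case: (hlt _ _ _ aa').
- by case: (hlt _ _ _ bb').
- by split=> /irr.
Qed.

(** The partners of the points below [y] all precede those of the points above [y]; [dlo_cut] finds
    an interval between these two finite sets. *)
Lemma partial_iso_cut (r : sorted_rel M) i y : partial_iso r ->
  (forall y', ~ r (Rs i) y y') ->
  exists a b, ltM M i a b /\ forall y', ltM M i a y' -> ltM M i y' b ->
    forall z z', r (Rs i) z z' ->
     (ltM M i z y <-> ltM M i z' y') /\ (ltM M i y z <-> ltM M i y' z').
Proof.
move=> r_iso ndom; have [irr tr tot] := sto i.
have fin_img P : finite_set [set z' | exists2 z, r (Rs i) z z' & P z].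
  apply: sub_finite_set (finite_image snd (pi_fin r_iso i)).
  by move=> z' [z zz' _]; exists (z, z').
have [|a [b [ab aL bU]]] := dlo_cut y (VO_dlo M_VO i)
    (fin_img (fun z => ltM M i z y)) (fin_img (fun z => ltM M i y z)).
  move=> l u [z zl zy] [t tu yt].
  by apply/(pi_lt r_iso zl tu); exact: tr zy yt.
exists a, b; split=> // y' ay' y'b z z' zz'.
case: (tot z y) => [zy|e|yz]; last 2 first.
- by case: (ndom z'); rewrite -e.
- have y'z' : ltM M i y' z'.
    by apply: (strict_total_RN (sto i) y'b); apply: bU; exists z.
  split; split=> // h; exfalso.
    by apply: (irr y); exact: tr yz h.
  by apply: (irr y'); exact: tr y'z' h.
have z'y' : ltM M i z' y'.
  by apply: (strict_total_NR (sto i) _ ay'); apply: aL; exists z.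
split; split=> // h; exfalso.
  by apply: (irr y); exact: tr h zy.
by apply: (irr y'); exact: tr h z'y'.
Qed.

Lemma partial_iso_forth_R0 (r : sorted_rel M) x : partial_iso r ->
  exists r' x', [/\ partial_iso r', forall s a b, r s a b -> r' s a b &
    r' R0 x x'].
Proof.
move=> r_iso; have [[x' xx']|ndom] := pselect (exists x', r R0 x x').
  by exists r, x'.
have ndomf i y' : ~ r (Rs i) (fM M i x) y'.
  by move=> /(pi_g r_iso); rewrite gfK => h; apply: ndom; eexists; exact: h.
have cut i := cid (partial_iso_cut r_iso (ndomf i)).
have cut' i := cid (projT2 (cut i)).
(* Axiom (5) puts all the f_i(x') in their prescribed gaps simultaneously. *)
have [x' x'P] := VO_indep M_VO (fun i => (projT2 (cut' i)).1).
exists (add_pairs r x x' (fun i => fM M i x) (fun i => fM M i x')), x'; split.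
- apply: partial_iso_add => // [i|i|i z z' zz'].
  + by right.
  + by rewrite !gfK; right.
  + by have [_] := projT2 (cut' i); apply=> //; case: (x'P i).
- by move=> [|i] a b; left.
- by right.
Qed.

(** A point of the range of f_i reduces to the sort [R0]. Any other new point is matched by
    co-density with a point off the range, and g_i sends both to 0. *)
Lemma partial_iso_forth (r : sorted_rel M) s (x : M s) : partial_iso r ->
  exists r' x', [/\ partial_iso r', forall s a b, r s a b -> r' s a b &
    r' s x x'].
Proof.
move=> r_iso; case: s x => [|i] y; first exact: partial_iso_forth_R0.
have [[y' yy']|ndom] := pselect (exists y', r (Rs i) y y').
  by exists r, y'.
have [[x _ xy]|nfy] := pselect (range (fM M i) y).
  have [r' [x' [r'_iso rr' xx']]] := partial_iso_forth_R0 x r_iso.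
  by exists r', (fM M i x'); split=> //; rewrite -xy; exact: pi_f.
have ndom' y' : ~ r (Rs i) y y' by move=> yy'; apply: ndom; exists y'.
have [a [b [ab abP]]] := partial_iso_cut r_iso ndom'.
have [y' [nfy' ay' y'b]] := VO_codense M_VO ab.
pose z := zeroM M; pose ext t := dfwith (fun j => fM M j z) (t : M (Rs i)).
(* Only the pair at index [i] is new: the others already belong to [r].       *)
exists (add_pairs r z z (ext y) (ext y')), y'; split.
- apply: partial_iso_add => // [j|j|j t t' tt'].
  + by left; apply/(pi_f r_iso)/(pi_zero r_iso).
  + left; rewrite /ext; have [e|ij] := eqVneq i j.
      case: j / e; rewrite !dfwith_in !(VO_g_out M_VO) //.
      exact: pi_zero.
    rewrite !dfwith_out // !gfK; exact: pi_zero.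
  + rewrite /ext; have [e|ij] := eqVneq i j.
      by case: j / e t t' tt' => t t' tt'; rewrite !dfwith_in; exact: abP.
    rewrite !dfwith_out //.
    have zz : r (Rs j) (fM M j z) (fM M j z) by apply/(pi_f r_iso)/(pi_zero r_iso).
    by split; apply: (pi_lt r_iso).
- by move=> [|j] c d; left.
- by right; rewrite /ext !dfwith_in.
Qed.

Fixpoint env_rel (r : sorted_rel M) (G : seq (vsort n)) :
    env M G -> env M G -> Prop :=
  match G return env M G -> env M G -> Prop with
  | [::] => fun _ _ => True
  | s :: G' => fun e e' => r s e.1 e'.1 /\ env_rel r e.2 e'.2
  end.

Lemma env_relS (r r' : sorted_rel M) G (e e' : env M G) :
  (forall s a b, r s a b -> r' s a b) -> env_rel r e e' -> env_rel r' e e'.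
Proof.
move=> rr'; elim: G e e' => [//|s G IH] e e' /= [h1 h2].
by split; [exact: rr'|exact: IH].
Qed.

Lemma env_rel_flip (r : sorted_rel M) G (e e' : env M G) :
  env_rel r e e' -> env_rel (fun s x y => r s y x) e' e.
Proof. by elim: G e e' => [//|s G IH] e e' /= [h1 /IH]. Qed.

Lemma eval_rel (r : sorted_rel M) G s (t : term G s) (e e' : env M G) :
  partial_iso r -> env_rel r e e' -> r s (eval t e) (eval t e').
Proof.
move=> r_iso ee'; elim: t => {s} [s v||i t IH|i t IH] /=.
- elim: v e e' ee' => {G s} [G s|G s t v IH] e e' /= [] //.
  by move=> _; exact: IH.
- exact: pi_zero.
- exact: pi_f.
- exact: pi_g.
Qed.

Lemma holds_rel G (phi : formula G) (r : sorted_rel M) (e e' : env M G) :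
  partial_iso r -> env_rel r e e' -> holds phi e <-> holds phi e'.
Proof.
elim: phi r e e' => {G} [G s t u|G i t u|G p IH|G p IHp q IHq|G s p IH]
  r e e' r_iso ee' /=.
- by apply: (partial_iso_eq r_iso); exact: eval_rel.
- by apply: (pi_lt r_iso); exact: eval_rel.
- by have h := IH r e e' r_iso ee'; tauto.
- by have [? ?] := IHp _ _ _ r_iso ee'; have [? ?] := IHq _ _ _ r_iso ee'; tauto.
(* Stated for every relation, so that the back direction is the forth direction of the flipped
   isomorphism. *)
have fwd r1 (e1 e2 : env M G) : partial_iso r1 -> env_rel r1 e1 e2 ->
    (exists a : M s, holds (M := M) p (a, e1)) ->
    exists a : M s, holds (M := M) p (a, e2).
  move=> r1_iso e12 [a pa].
  have [r' [a' [r'_iso rr' aa']]] := partial_iso_forth a r1_iso.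
  exists a'; apply/(IH r' (a, e1) (a', e2) r'_iso) => //.
  by split=> //; exact: env_relS e12.
split; first exact: fwd r_iso ee'.
exact: fwd (partial_iso_flip r_iso) (env_rel_flip ee').
Qed.

(** * Definable sets and cuts over the generated substructure *)

Variables (A : forall s : vsort n, set (M s)).
Arguments A : clear implicits.
Hypothesis A_fin : forall s : vsort n, finite_set (A s).

Lemma generated_finite s : finite_set (@generated n M A s).
Proof.
(* Closure stops after one round: since g_i inverts f_i, applying g_i to f_i(C0) gives nothing
   new. *)
pose C0 := A R0 `|` [set zeroM M] `|`
  \bigcup_(i in [set: 'I_n]) (gM M i @` A (Rs i)).
have C0fin : finite_set C0.
  rewrite /C0 !finite_setU; split; first by split=> //; exact: finite_set1.
  apply: bigcup_finite => [|i _]; first exact: finite_finset.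
  exact: finite_image.
pose C s := match s return set (M s) with
  | R0 => C0
  | Rs i => A (Rs i) `|` fM M i @` C0
  end.
have Cfin : finite_set (C s).
  case: s => [|i] //=; rewrite finite_setU; split=> //; exact: finite_image.
apply: sub_finite_set Cfin => x; elim=> {s x} [s a Aa||i x _ Cx|i y _ [Ay|[x Cx <-]]].
- by case: s a Aa => [|i] a Aa; [left; left|left].
- by left; right.
- by right; exists x.
- by right; exists i => //; exists y.
- by rewrite gfK.
Qed.

Local Notation C := (@generated n M A).

Lemma generated_fN x i : ~ C x -> ~ C (fM M i x).
Proof. by move=> nCx /(gen_g (i := i)); rewrite gfK. Qed.

(** The identity of C extended by x to x' and f_i(x) to f_i(x') is a partial isomorphism fixing the
    parameters. *)
Lemma definable_same_cut (E : set (M R0)) x x' : definable_over A E ->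
  (forall i, same_cut (ltM M i) (@C (Rs i)) (fM M i x) (fM M i x')) ->
  E x -> E x'.
Proof.
move=> [G [phi [a [Aa ->]]]] xx' /=.
pose r0 : sorted_rel M := fun s b c => C b /\ b = c.
have r0_iso : partial_iso r0.
  split=> [i||i b c [Cb <-]|i b c [Cb <-]|i b b' c c' [_ <-] [_ <-]] //=.
  - apply: sub_finite_set (finite_image (fun c => (c, c)) (generated_finite (Rs i))).
    by move=> [b c] [/= Cb <-]; exists b.
  - by split=> //; exact: gen_zero.
  - by split=> //; exact: gen_f.
  - by split=> //; exact: gen_g.
pose r := add_pairs r0 x x' (fun i => fM M i x) (fun i => fM M i x').
have r_iso : partial_iso r.
  apply: partial_iso_add => // [i|i|i z z' [Cz <-]]; last exact: xx'.
  - by right.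
  - by rewrite !gfK; right.
have aa : env_rel r a a.
  elim: G a Aa {phi} => [//|s G IH] [b a] /= [Ab /IH aa]; split=> //.
  by case: s b Ab => [|i] b Ab; left; split=> //; exact: gen_base.
have xaxa : env_rel r (G := R0 :: G) (x, a) (x', a) by split=> //; right.
by case: (holds_rel phi r_iso xaxa).
Qed.

Variables (E : set (M R0)) (E_def : definable_over A E).

(** The tuple [t] need not come from a point of [M R0]: axiom (5) supplies genuine points whose
    coordinates are near it, with the same cuts as [x]. *)
Lemma mset_neighborhood (K : intervals M) (t : forall i, M (Rs i)) x :
  (forall i, ~ C (t i)) -> (forall i, iset (K i) (t i)) ->
  (forall i, same_cut (ltM M i) (@C (Rs i)) (t i) (fM M i x)) ->
  exists I : intervals M, [/\ mset I !=set0, mset I `<=` mset K,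
    (forall i, iset (I i) (t i)) & forall x', mset I x' -> E x' <-> E x].
Proof.
move=> nCt Kt tx.
have nb i := cid (oint_nbhd (VO_dlo M_VO i) (generated_finite (Rs i))
  (nCt i) (Kt i)).
have nb' i := cid (projT2 (nb i)).
pose a i := projT1 (nb i); pose b i := projT1 (nb' i).
have abP i : [/\ ltM M i (a i) (t i), ltM M i (t i) (b i) &
    forall y, ltM M i (a i) y -> ltM M i y (b i) ->
      oint (ltM M i) (K i) y /\ same_cut (ltM M i) (@C (Rs i)) (t i) y].
  exact: (projT2 (nb' i)).
have ab i : ltM M i (a i) (b i).
  by have [at_ tb _] := abP i; have [_ tr _] := sto i; exact: tr tb.
exists (fun i => (Fin (a i), Fin (b i))); split.
- by have [x' x'P] := VO_indep M_VO ab; exists x'.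
- by move=> x' x'I i; have [_ _ h] := abP i; have [] := x'I i => u v; case: (h _ u v).
- by move=> i; have [] := abP i.
move=> x' x'I; have x'x i : same_cut (ltM M i) (@C (Rs i)) (fM M i x') (fM M i x).
  move=> c Cc; have [h1 h2] := tx i c Cc.
  have [_ _ h] := abP i; have [u v] := x'I i.
  have [_ /(_ c Cc)[h3 h4]] := h _ u v.
  by split; tauto.
split; first exact: definable_same_cut.
by apply: definable_same_cut => // i c Cc; have [h1 h2] := x'x i c Cc; split; tauto.
Qed.

Lemma mset_enlarge (B : intervals M) (e : M R0) (m : 'I_n) :
  mset B e -> mset B `<=` E ->
  exists K : ointerval M m, [/\ in_ext (@C (Rs m)) K.1, in_ext (@C (Rs m)) K.2,
    iset (B m) `<=` iset K & mset (dfwith B K) `<=` E].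
Proof.
move=> Be BE.
have [K [CK1 CK2 BK KP]] :=
  oint_extend (VO_dlo M_VO m) (generated_finite (Rs m)) (Be m).
exists K; split=> // x xK.
have xB j : m != j -> iset (B j) (fM M j x).
  by move=> mj; have := xK j; rewrite dfwith_out.
have := xK m; rewrite dfwith_in => /KP[xBm|[nCx [y By xy]]].
  by apply: BE => j; have [<-|/xB] := eqVneq m j.
have nCx0 : ~ C x by move=> /(gen_f m).
(* Replacing the m-th coordinate of [x] by [y] keeps every cut and moves the tuple into [B]; a point
   of [B] near it lies in [E], hence so does [x]. *)
pose t := dfwith (fun j => fM M j x) y.
have tx i : same_cut (ltM M i) (@C (Rs i)) (t i) (fM M i x).
  rewrite /t; case: dfwithP => [|j _] c Cc; last by split.
  by have [h1 h2] := xy c Cc; split; tauto.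
have Bt i : iset (B i) (t i).
  by rewrite /t; case: dfwithP => // j /xB.
have nCt i : ~ C (t i).
  rewrite /t; case: dfwithP => [|j _]; last exact: generated_fN.
  exact: same_cut_notin xy nCx.
have [I [[x' Ix'] IB _ IE]] := mset_neighborhood nCt Bt tx.
by apply/(IE x') => //; apply/BE/IB.
Qed.

(** * The largest multi-interval around a point *)

(** [extendable] with [K] and the auxiliary intervals packed into one box, the form to which
    [mset_enlarge] applies. *)
Definition box_extendable (e : M R0) (I : intervals M) (m : 'I_n)
    (K : ointerval M m) : Prop :=
  exists B : intervals M, [/\ mset B e, mset B `<=` E,
    forall l : 'I_n, (l < m)%N -> B l = I l & B m = K].

Lemma extendable_box e (I : intervals M) (m : 'I_n) (K : ointerval M m) :
  (forall l : 'I_n, (l < m)%N -> iset (I l) (fM M l e)) ->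
  extendable E e I K <-> box_extendable e I K.
Proof.
move=> Ie; split=> [[Ke [J [Je JE]]]|[B [Be BE BI BK]]].
  pose IJ : intervals M := fun j => if (j < m)%N then I j else J j.
  pose B : intervals M := dfwith IJ K.
  have Bm : B m = K by rewrite /B dfwith_in.
  have Bl (l : 'I_n) : (l < m)%N -> B l = I l.
    by move=> lm; rewrite /B dfwith_out /IJ ?lm // -val_eqE /= gtn_eqF.
  have Bj (j : 'I_n) : (m < j)%N -> B j = J j.
    move=> mj; rewrite /B dfwith_out /IJ; first by rewrite ltnNge (ltnW mj).
    by rewrite -val_eqE /= ltn_eqF.
  exists B; split=> // [j|x Bx].
    case: (ltngtP j m) => [jm|mj|/val_inj ->].
    - by rewrite Bl //; exact: Ie.
    - by rewrite Bj //; exact: Je.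
    - by rewrite Bm.
  apply: JE; split=> [l lm||j mj].
  - by rewrite -Bl.
  - by rewrite -Bm.
  - by rewrite -Bj.
split; first by rewrite -BK.
exists B; split=> [j _|x [xI xK xB]]; first exact: Be.
apply: BE => j; case: (ltngtP j m) => [jm|mj|/val_inj ->].
- by rewrite BI //; exact: xI.
- exact: xB.
- by rewrite BK.
Qed.

(** Endpoints may be taken in C or infinite, which leaves finitely many candidates. The one reaching
    furthest left and the one reaching furthest right both contain f_m(e), and their union is again
    admissible. *)
Lemma box_extendable_largest e (I : intervals M) (m : 'I_n) :
  mset I e -> mset I `<=` E ->
  exists K : ointerval M m, [/\ in_ext (@C (Rs m)) K.1, in_ext (@C (Rs m)) K.2,
    box_extendable e I K &
    forall K' : ointerval M m, box_extendable e I K' -> iset K' `<=` iset K].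
Proof.
move=> Ie IE; have Rl := lt_ext_strict_total (sto m).
have enl (K : ointerval M m) : box_extendable e I K ->
    exists K' : ointerval M m, [/\ in_ext (@C (Rs m)) K'.1,
      in_ext (@C (Rs m)) K'.2, iset K `<=` iset K' & box_extendable e I K'].
  move=> [B [Be BE BI <-]].
  have [K' [CK1 CK2 BK K'E]] := mset_enlarge m Be BE; exists K'; split=> //.
  exists (dfwith B K'); split=> // [j|l lm|]; last exact: dfwith_in.
    by case: dfwithP => // ; exact: BK.
  by rewrite dfwith_out ?BI // -val_eqE /= gtn_eqF.
have extI : box_extendable e I (I m) by exists I.
have [[a b] [/= Ca Cb _ extab]] := enl _ extI.
have [||a0 [Ca0 [b0 Cb0 ext0]] a0min] := @finite_max _ _
    [set a | in_ext (@C (Rs m)) a /\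
             exists2 b, in_ext (@C (Rs m)) b & box_extendable e I (a, b)]
    (strict_total_flip Rl).
- by apply: sub_finite_set (finite_in_ext (generated_finite (Rs m))) => c [].
- by exists a; split=> //; exists b.
have [||b1 [Cb1 [a1 Ca1 ext1]] b1max] := @finite_max _ _
    [set b | in_ext (@C (Rs m)) b /\
             exists2 a, in_ext (@C (Rs m)) a & box_extendable e I (a, b)]
    Rl.
- by apply: sub_finite_set (finite_in_ext (generated_finite (Rs m))) => c [].
- by exists b; split=> //; exists a.
exists (a0, b1); split=> //; last first.
  move=> K' /enl[[a' b'] [/= Ca' Cb' K'sub ext']] y /K'sub[a'y yb'].
  split.
    by apply: (strict_total_NR Rl _ a'y); apply: a0min; split=> //; exists b'.
  by apply: (strict_total_RN Rl yb'); apply: b1max; split=> //; exists a'.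
have [B0 [B0e B0E B0I B0m]] := ext0; have [B1 [B1e B1E B1I B1m]] := ext1.
(* The later intervals of the two boxes are intersected so as to suit both. *)
have cap j := cid (oint_capS (sto j) (B0e j) (B1e j)).
pose J j := projT1 (cap j).
have JP j : oint (ltM M j) (J j) (fM M j e) /\
    oint (ltM M j) (J j) `<=` oint (ltM M j) (B0 j) `&` oint (ltM M j) (B1 j).
  exact: (projT2 (cap j)).
pose K : ointerval M m := (a0, b1).
have Ke : iset K (fM M m e).
  by have := B0e m; have := B1e m; rewrite B0m B1m => -[_ ?] [? _]; split.
apply/extendable_box => [l _|]; first exact: Ie.
split=> //; exists J; split=> [j _|x [xI [a0x xb1] xJ]].
  by case: (JP j).
have [_ ext_tr tot] := Rl.
(* To the left of f_m(e) the point lies in [B0], otherwise in [B1]. *)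
have [xe|nxe] := pselect (ltM M m (fM M m x) (fM M m e)).
  apply: B0E => j; case: (ltngtP j m) => [jm|mj|/val_inj ->].
  - by rewrite B0I //; exact: xI.
  - by have [_ h] := JP j; case: (h _ (xJ j mj)).
  - rewrite B0m; split=> //; have := B0e m; rewrite B0m => -[_].
    exact: (ext_tr _ (Fin (fM M m e))).
apply: B1E => j; case: (ltngtP j m) => [jm|mj|/val_inj ->].
- by rewrite B1I //; exact: xI.
- by have [_ h] := JP j; case: (h _ (xJ j mj)).
- rewrite B1m; split=> //; have := B1e m; rewrite B1m => -[h _].
  exact: (strict_total_RN Rl h).
Qed.

(** Each interval contains all admissible ones, whereas [maximal_in] only asks that no admissible
    one be strictly larger; containment of all is what gives uniqueness. *)
Definition largest_in (e : M R0) (I : intervals M) : Prop :=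
  [/\ mset I e, mset I `<=` E &
    forall m (K : ointerval M m), box_extendable e I K -> iset K `<=` iset (I m)].

Lemma box_extendable_eq e (I I' : intervals M) (m : 'I_n) (K : ointerval M m) :
  (forall l : 'I_n, (l < m)%N -> I l = I' l) ->
  box_extendable e I K -> box_extendable e I' K.
Proof.
move=> II' [B [Be BE BI BK]]; exists B; split=> // l lm.
by rewrite BI // II'.
Qed.

Lemma largest_in_exists e (I0 : intervals M) :
  mset I0 e -> mset I0 `<=` E ->
  exists2 I, largest_in e I &
    forall i, in_ext (@C (Rs i)) (I i).1 /\ in_ext (@C (Rs i)) (I i).2.
Proof.
move=> I0e I0E.
suff /(_ n (leqnn n)) [I [Ie IE IP]] : forall k, (k <= n)%N ->
    exists I, [/\ mset I e, mset I `<=` E & forall m : 'I_n, (m < k)%N ->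
    [/\ in_ext (@C (Rs m)) (I m).1, in_ext (@C (Rs m)) (I m).2 &
      forall K : ointerval M m, box_extendable e I K -> iset K `<=` iset (I m)]].
  exists I; first by split=> // m; case: (IP m).
  by move=> m; case: (IP m).
elim=> [_|k IH kn]; first by exists I0.
have [I [Ie IE IP]] := IH (ltnW kn); pose m := Ordinal kn.
have [K [CK1 CK2 [B [Be BE BI BK]] Kmax]] := box_extendable_largest m Ie IE.
(* The box witnessing admissibility of [K] keeps the earlier intervals, and their maximality depends
   only on intervals of smaller index. *)
exists B; split=> // l; rewrite ltnS leq_eqVlt => /orP[/eqP lk|lk].
  have -> : l = m by apply: val_inj.
  rewrite BK; split=> // K' K'ext; apply: Kmax.
  exact: box_extendable_eq K'ext.
have [C1 C2 lmax] := IP l lk; rewrite BI //; split=> // K' K'ext; apply: lmax.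
apply: box_extendable_eq K'ext => j jl; apply: BI; exact: ltn_trans lk.
Qed.

Lemma mset_multi_interval (I : intervals M) e : mset I e -> multi_interval I.
Proof. by move=> Ie i; exists (fM M i e). Qed.

Lemma largest_in_maximal e I : largest_in e I -> maximal_in E e I.
Proof.
move=> [Ie IE Imax]; split=> //; first exact: mset_multi_interval Ie.
move=> m; split; first by apply/extendable_box => //; exists I.
move=> K /extendable_box Kext IK; apply/seteqP; split=> //.
by apply: Imax; apply: Kext.
Qed.

(** Induction on the coordinate: once the earlier intervals agree, the same intervals are admissible
    for both families. Equal intervals then have equal endpoints by [oint_endpoints_inj]. *)
Lemma maximal_in_largest e I I' :
  largest_in e I -> maximal_in E e I' -> I' = I.
Proof.
move=> [Ie IE Imax] [_ I'e I'E I'max]; apply: functional_extensionality_dep.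
suff h : forall k (m : 'I_n), (m < k)%N -> I' m = I m by move=> m; exact: (h n).
elim=> // k IH m; rewrite ltnS leq_eqVlt => /orP[/eqP mk|]; last exact: IH.
have eqlm (l : 'I_n) : (l < m)%N -> I l = I' l by rewrite mk => /IH.
have [/extendable_box I'ext I'm] := I'max m.
have sub : iset (I' m) `<=` iset (I m).
  by apply: Imax; apply: (box_extendable_eq _ (I'ext _)) => // l /eqlm.
apply: (oint_endpoints_inj (sto m)); first by exists (fM M m e); exact: I'e.
apply/esym/I'm => //; apply/extendable_box => //.
by exists I; split.
Qed.

End Models.

(** * Finiteness of the decomposition and its uniqueness *)

Lemma finite_dependent_functions (T : finType) (U : T -> Type)
    (D : forall i, set (U i)) : (forall i, finite_set (D i)) ->
  finite_set [set f : forall i, U i | forall i, D i (f i)].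
Proof.
move=> Dfin.
have [[f0 _]|/set0P/negP/negPn/eqP ->] :=
  pselect ([set f : forall i, U i | forall i, D i (f i)] !=set0); last first.
  exact: finite_set0.
(* A member [f0] of the set provides the default values of the enumerations. *)
have enumD i := cid (finite_enum (f0 i) (Dfin i)).
have enumD' i := cid (projT2 (enumD i)).
pose g i := projT1 (enumD i); pose k i := projT1 (enumD' i).
have Dg i : D i = g i @` `I_(k i) := projT2 (enumD' i).
pose phi (h : {dffun forall i, 'I_(k i)}) i := g i (h i).
apply: (@sub_finite_set _ _ (phi @` [set: {dffun forall i, 'I_(k i)}])).
  move=> f Df; have idx i : exists j : 'I_(k i), g i j = f i.
    by have := Df i; rewrite Dg => -[j jk gj]; exists (Ordinal jk).
  exists (finfun (fun i => projT1 (cid (idx i)))) => //.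
  apply: functional_extensionality_dep => i.
  by rewrite /phi ffunE; exact: (projT2 (cid (idx i))).
by apply: finite_image; exact: finite_finset.
Qed.

Theorem theorem3p8 (n : nat) (n_ge1 : (1 <= n)%N) (M : structure n)
    (M_VO : VO M) (A : forall s : vsort n, set (M s))
    (A_fin : forall s : vsort n, finite_set (A s))
    (E : set (M R0)) (E_def : definable_over A E) :
  exists (B : set nat) (I : nat -> intervals M) (E0 : set (M R0)),
    [/\ canonical_decomposition E B I E0,
        (forall (B' : set nat) (I' : nat -> intervals M) (E0' : set (M R0)),
           canonical_decomposition E B' I' E0' ->
           [set I' j | j in B'] = [set I j | j in B] /\ E0' = E0) &
        (forall (j : nat) (i : 'I_n), B j ->
           in_ext (generated A (s:=Rs i)) (I j i).1 /\
           in_ext (generated A (s:=Rs i)) (I j i).2)].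
Proof.
pose Cfin := generated_finite M_VO A_fin.
pose inbox e := exists I' : intervals M,
  [/\ multi_interval I', mset I' e & mset I' `<=` E].
pose E0 := [set e | E e /\ ~ inbox e].
have large e : (E `\` E0) e -> exists2 I, largest_in E e I &
    forall i, in_ext (generated A (s:=Rs i)) (I i).1 /\
              in_ext (generated A (s:=Rs i)) (I i).2.
  move=> [Ee nE0]; have [[I' [_ I'e I'E]]|nb] := pselect (inbox e).
    exact: (largest_in_exists n_ge1 M_VO A_fin E_def I'e I'E).
  by case: nE0.
pose S := [set I | exists2 e, (E `\` E0) e & maximal_in E e I].
have SC (I : intervals M) : S I -> forall i,
    in_ext (generated A (s:=Rs i)) (I i).1 /\
    in_ext (generated A (s:=Rs i)) (I i).2.
  move=> [e /large [I1 I1l I1C] Imax].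
  by rewrite (maximal_in_largest M_VO I1l Imax).
have Sfin : finite_set S.
  have Dfin i : finite_set [set K : ointerval M i |
      in_ext (generated A (s:=Rs i)) K.1 /\ in_ext (generated A (s:=Rs i)) K.2].
    by apply: finite_setX; exact: finite_in_ext.
  by apply: sub_finite_set (finite_dependent_functions Dfin) => I /SC.
(* The whole lines are only the default value outside the enumeration. *)
have [I [k Ik]] := finite_enum (fun i => (MInfty, PInfty) : ointerval M i) Sfin.
have IS j : `I_k j -> S (I j) by move=> jk; rewrite Ik; exists j.
have E0fin : finite_set E0.
  apply: sub_finite_set (Cfin R0) => e [Ee nb]; apply: contrapT => nCe.
  apply: nb.
  (* If [e] is not in C, neither is any f_i(e), so [e] has a neighbourhood inside [E]; hence
     isolated points lie in C. *)
  have [|||I' [_ _ I'e I'E]] := mset_neighborhood n_ge1 M_VO A_fin E_def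
     (K := fun i => (MInfty, PInfty)) (t := fun i => fM M i e) (x := e) => //.
    by move=> i; exact: generated_fN.
  exists I'; split=> //; first exact: mset_multi_interval I'e.
  by move=> x /I'E ->.
have cover e : (E `\` E0) e -> exists2 j, `I_k j & maximal_in E e (I j).
  move=> E1; have [I1 /largest_in_maximal I1m _] := large e E1.
  have : S I1 by exists e.
  by rewrite Ik => -[j jk jI1]; exists j => //; rewrite jI1.
exists `I_k, I, E0; split=> [|B' I' E0' cd|j i /IS/SC] //.
  split=> //.
  - by move=> e [].
  - by move=> j /IS[e _ []].
  - apply/seteqP; split=> [e Ee|e [[j /IS[e' _ [_ _ jE _]]]|[]]] //; last exact: jE.
    have [E0e|nE0e] := pselect (E0 e); first by right.
    by have [j jk [_ je _ _]] := cover e (conj Ee nE0e); left; exists j.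
  - by move=> e [].
have E0E : E0' = E0.
  apply/seteqP; split=> e; first by move=> E0e;
    split; [exact: (cd_subE0 cd)|exact: (cd_isolated cd)].
  move=> [Ee nb]; apply: contrapT => nE0'.
  have [j _ [h1 h2 h3 _]] := cd_cover cd (conj Ee nE0').
  by apply: nb; exists (I' j).
split=> //; rewrite -Ik; apply/seteqP; split=> [_ [j B'j <-]|I1 [e E1 I1m]].
  by have := cd_used cd B'j; rewrite E0E.
(* Both decompositions contain a maximal multi-interval at [e], and each equals the largest one. *)
have [j B'j jm] := cd_cover cd (e := e) ltac:(by rewrite E0E).
exists j => //; have [I2 I2l _] := large e E1.
by rewrite (maximal_in_largest M_VO I2l I1m) (maximal_in_largest M_VO I2l jm).
Qed.
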